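(* Let $H$ be a real Hilbert space and let $T:H\to H$ be a nonexpansive operator with $Fix(T)=\{x\in H:Tx=x\}\neq\varnothing$. Let $z^{0},z^{-1}\in H$, let $\{e^k\}_{k\ge0}$ be a sequence in $H$, let $\{\alpha_k\},\{\lambda_k\}$ be real sequences, and define for $k\ge0$ $$\mu^{k}=z^{k}+\alpha_{k}(z^{k}-z^{k-1}),\qquad z^{k+1}=\mu^{k}+\lambda_{k}(T\mu^{k}+e^{k}-\mu^{k}).$$ Assume that one of the following two sets of hypotheses holds. Case 1: there are constants $\alpha\in[0,1)$ and $0<\lambda\le\lambda'<1$ with $0\le\alpha_k\le\alpha$ and $\lambda\le\lambda_k\le\lambda'$ for all $k$; $\sum_{k=0}^{+\infty}\alpha_k\|z^{k+1}-z^k\|^2<+\infty$; $\sum_{k=0}^{+\infty}\lambda_k\|e^k\|<+\infty$; and $\{z^k\}$ is bounded. In this case set $\theta=\lambda'$. Case 2: $\{\alpha_k\},\{\lambda_k\}$ are nondecreasing; there is $\alpha\in[0,1)$ with $0\le\alpha_k\le\alpha$ for all $k$ and $\alpha_0=0$; there are $\lambda,\sigma,\delta>0$ with $\delta>\frac{\alpha[\alpha(1+\alpha)+\sigma]}{1-\alpha^2}$ and $0<\lambda\le\lambda_k\le\frac{\delta-\alpha[\alpha(1+\alpha)+\alpha\delta+\sigma]}{\delta[1+\alpha(1+\alpha)+\alpha\delta+\sigma]}$ for all $k$; $\{z^k\}$ is bounded; and $\sum_{k=0}^{+\infty}\|e^k\|<+\infty$. In this case set $\theta=\frac{\delta-\alpha[\alpha(1+\alpha)+\alpha\delta+\sigma]}{\delta[1+\alpha(1+\alpha)+\alpha\delta+\sigma]}$.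 Then for every $z^*\in Fix(T)$ the quantity $$\Delta=\alpha\sum_{k=1}^{\infty}\big[\|z^k-z^*\|^2-\|z^{k-1}-z^*\|^2\big]_+ +\sum_{k=1}^{\infty}2\|z^{k+1}-z^*\|\,\lambda_k\|e^k\|+\sum_{k=1}^{\infty}\alpha_k(1+\alpha_k)\|z^k-z^{k-1}\|^2$$ is finite, where $[m]_+=\max\{m,0\}$, and for every $k\ge1$ $$\min_{1\le i\le k}\|T\mu^i-\mu^i\|^2\le\frac{1}{k\lambda(1-\theta)}\big(\|z^1-z^*\|^2+\Delta\big).$$ *)

(* Defs.v *)
From HB Require Import structures.
From mathcomp Require Import all_boot all_order all_algebra.
From mathcomp Require Import all_classical all_reals all_analysis.
Set Implicit Arguments. Unset Strict Implicit. Unset Printing Implicit Defensive.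
Import Order.TTheory GRing.Theory Num.Theory.
Import numFieldNormedType.Exports.
Local Open Scope ring_scope.

(* The norm of V is induced by a real inner product [ip]:
   ip is symmetric, linear in its first argument, and ip x x = |x|^2.
   Together with completeness of V this makes V a real Hilbert space. *)
Definition inner_product_norm (R : realType) (V : normedModType R)
  (ip : V -> V -> R) : Prop :=
  [/\ (forall x y : V, ip x y = ip y x),
      (forall (a : R) (x y w : V), ip (a *: x + y) w = a * ip x w + ip y w)
    & (forall x : V, ip x x = `|x| ^+ 2)].

Definition nonexpansive (R : realType) (V : normedModType R) (T : V -> V) :=
  forall x y : V, `|T x - T y| <= `|x - y|.

Definition zprev (R : realType) (V : normedModType R) (z : nat -> V) (zm1 : V)
  (k : nat) : V := if k is k'.+1 then z k' else zm1.

Definition mu_seq (R : realType) (V : normedModType R) (z : nat -> V) (zm1 : V)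
  (alpha : nat -> R) (k : nat) : V :=
  z k + alpha k *: (z k - zprev z zm1 k).

(* Main.v *)
Require Import Defs.
From HB Require Import structures.
From mathcomp Require Import all_boot all_order all_algebra.
From mathcomp Require Import all_classical all_reals all_analysis.
From mathcomp Require Import ring lra.
Import Order.TTheory GRing.Theory Num.Theory.
Import numFieldNormedType.Exports.
Local Open Scope ring_scope.

(* Nonexpansiveness of T gives the perturbed Fejer inequality [fejer_step] for
   phi_k = |z^k - z*|^2; summing it bounds the residuals by |z^1 - z*|^2 + Delta.
   Finiteness of Delta reduces to that of the sum of alpha_k |z^k - z^(k-1)|^2:
   the positive parts of the increments of phi then satisfy a linear recursion
   of ratio a < 1 with a summable perturbation.

   In case 2 this sum is finite because
   phi_k - alpha_k phi_(k-1) + G |z^k - z^(k-1)|^2 decreases, up to summable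
   errors, by sigma |z^(k+1) - z^k|^2.  In case 1 only the sum of
   alpha_k |z^(k+1) - z^k|^2 is assumed finite and alpha_k is not monotone.
   When alpha_(k+1) is much larger than alpha_k, the step z^(k+1) - z^k is
   controlled by the next step, which is weighted by alpha_(k+1), and by the
   increment of the residual T z - z along this step; the square of that
   increment is paid for by the decrease of |T z - z|^2. *)

(** * Series of reals, handled through upper bounds on their partial sums *)

Section BoundedSums.
Context {R : realType}.
Implicit Types (u v w x s : nat -> R).

(** For nonnegative terms this is convergence; with partial sums, comparison and telescoping remain
    finite real arithmetic. *)
Definition bounded_sums u := exists S : R, forall n, \sum_(k < n) u k <= S.

Lemma le_bounded_sums u v :
  (forall k, u k <= v k) -> bounded_sums v -> bounded_sums u.
Proof.
move=> uv [S HS]; exists S => n; apply: le_trans (HS n).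
by apply: ler_sum => k _.
Qed.

Lemma bounded_sumsD u v : bounded_sums u -> bounded_sums v ->
  bounded_sums (fun k => u k + v k).
Proof.
move=> [S HS] [S' HS']; exists (S + S') => n.
by rewrite big_split lerD.
Qed.

Lemma bounded_sumsZ (c : R) u : 0 <= c -> bounded_sums u ->
  bounded_sums (fun k => c * u k).
Proof.
move=> c0 [S HS]; exists (c * S) => n.
by rewrite -mulr_sumr ler_wpM2l.
Qed.

Lemma bounded_sumsS u : (forall k, 0 <= u k) -> bounded_sums u ->
  bounded_sums (fun k => u k.+1).
Proof.
move=> u0 [S HS]; exists S => n; apply: le_trans (HS n.+1).
by rewrite big_ord_recl lerDr.
Qed.

Lemma bounded_sums_term u : (forall k, 0 <= u k) -> bounded_sums u ->
  exists E : R, forall k, u k <= E.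
Proof.
move=> u0 [S HS]; exists S => k; apply: le_trans (HS k.+1).
by rewrite big_ord_recr/= lerDr sumr_ge0.
Qed.

(** Summation telescopes [w], whose total drop is capped by [B], and the sum of the [b * x k] is
    absorbed on the left because [b < c]. The potential [w] will be the squared residual in case 1,
    a Lyapunov function in case 2, and zero for the increments of phi. *)
Lemma bounded_sums_rec x w s (b c B : R) :
  0 <= b -> b < c -> (forall k, 0 <= x k) -> (forall k, B <= w k) ->
  bounded_sums s ->
  (forall k, c * x k.+1 <= w k - w k.+1 + b * x k + s k) ->
  bounded_sums x.
Proof.
move=> b0 bc x0 wB [S HS] H.
exists ((w 0 - B + S + c * x 0) / (c - b)) => n.
rewrite ler_pdivlMr ?subr_gt0//.
(* The left sum has one term more than the right one, so the induction step adds exactly [H n]. *)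
have tel : c * \sum_(k < n.+1) x k <=
    c * x 0 + w 0 - w n + b * \sum_(k < n) x k + \sum_(k < n) s k.
  elim: n => [|n IHn].
    by rewrite big_ord_recr/= !big_ord0; lra.
  have xS m : \sum_(k < m.+1) x k = \sum_(k < m) x k + x m.
    by rewrite big_ord_recr.
  have -> : \sum_(k < n.+1) s k = \sum_(k < n) s k + s n.
    by rewrite big_ord_recr.
  have := IHn; have := H n; rewrite (xS n.+1) (xS n) !mulrDr; lra.
have := HS n; have := wB n.
have : c * \sum_(k < n) x k <= c * \sum_(k < n.+1) x k.
  by rewrite ler_pM2l ?(le_lt_trans b0)// big_ord_recr lerDl.
lra.
Qed.

(** * Passage between bounded partial sums and extended-real series *)

Lemma bounded_sums_lt_pinfty u : (forall k, 0 <= u k) ->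
  (\sum_(0 <= k <oo) (u k)%:E < +oo)%E -> bounded_sums u.
Proof.
move=> u0; set s := (X in (X < _)%E) => soo.
have s0 : (0 <= s)%E by apply: nneseries_ge0 => k _ _; rewrite lee_fin.
exists (fine s) => n; rewrite -lee_fin fineK; last first.
  by rewrite fin_numE gt_eqF ?(lt_le_trans _ s0)// lt_eqF.
rewrite -sumEFin -(big_mkord xpredT (fun k => (u k)%:E)).
by apply: nneseries_lim_ge => k _ _; rewrite lee_fin.
Qed.

Lemma nneseries1_lt_pinfty u : (forall k, 0 <= u k.+1) ->
  bounded_sums (fun k => u k.+1) -> (\sum_(1 <= k <oo) (u k)%:E < +oo)%E.
Proof.
move=> u0 [S HS]; apply: (@le_lt_trans _ _ S%:E); last exact: ltry.
apply: lime_le.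
  by apply: is_cvg_nneseries => -[//|n] _ _; rewrite lee_fin.
apply: nearW => -[|n].
  by rewrite big_geq// lee_fin; have := HS 0; rewrite big_ord0.
by rewrite big_add1 big_mkord sumEFin lee_fin.
Qed.

Lemma sum_le_nneseries1 u n : (forall k, 0 <= u k.+1) ->
  ((\sum_(k < n) u k.+1)%:E <= \sum_(1 <= k <oo) (u k)%:E)%E.
Proof.
move=> u0; rewrite -sumEFin -(big_mkord xpredT (fun k => (u k.+1)%:E)).
rewrite -(big_add1 _ _ 0 n.+1 xpredT (fun k => (u k)%:E)).
by apply: nneseries_lim_ge => -[//|k] _ _; rewrite lee_fin.
Qed.

End BoundedSums.

(** * Inner product calculus *)

Section Hilbert.
Context {R : realType} {V : normedModType R} {ip : V -> V -> R}.
Hypothesis ipH : inner_product_norm ip.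
Implicit Types x y w f : V.

Lemma ipC x y : ip x y = ip y x.
Proof. by case: ipH. Qed.

Lemma ipDl x y w : ip (x + y) w = ip x w + ip y w.
Proof. by case: ipH => _ + _ => /(_ 1 x y w); rewrite scale1r mul1r. Qed.

Lemma ipZl (c : R) x w : ip (c *: x) w = c * ip x w.
Proof.
case: ipH => _ H _; have := H (-1) x x w; have := H c x 0 w.
have := H (-1) 0 0 w.
by rewrite scaler0 scaleN1r !addr0 addNr; lra.
Qed.

Lemma ipDr x y w : ip w (x + y) = ip w x + ip w y.
Proof. by rewrite ![ip w _]ipC ipDl. Qed.

Lemma ipZr (c : R) x w : ip w (c *: x) = c * ip w x.
Proof. by rewrite ![ip w _]ipC ipZl. Qed.

Lemma normsqE x : `|x| ^+ 2 = ip x x.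
Proof. by case: ipH. Qed.

Lemma normsqD x y : `|x + y| ^+ 2 = `|x| ^+ 2 + 2 * ip x y + `|y| ^+ 2.
Proof. by rewrite !normsqE ipDl !ipDr [ip y x]ipC; ring. Qed.

(** The triangle inequality is already known for the norm; squaring and expanding it leaves this. *)
Lemma cauchy_schwarz x y : ip x y <= `|x| * `|y|.
Proof.
have h : `|x + y| ^+ 2 <= (`|x| + `|y|) ^+ 2.
  by rewrite lerXn2r ?nnegrE ?addr_ge0// ler_normD.
by move: h; rewrite normsqD sqrrD -mulr_natl; lra.
Qed.

Lemma ipNl x w : ip (- x) w = - ip x w.
Proof. by rewrite -scaleN1r ipZl mulN1r. Qed.

Lemma ipNr x w : ip w (- x) = - ip w x.
Proof. by rewrite ipC ipNl ipC. Qed.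

Definition ipE := (ipDl, ipDr, ipNl, ipNr, ipZl, ipZr).

Lemma normsq_subZ (c : R) x y : `|x - c *: y| ^+ 2 =
  `|x| ^+ 2 - 2 * c * ip x y + c ^+ 2 * `|y| ^+ 2.
Proof. by rewrite !normsqE !ipE [ip y x]ipC; ring. Qed.

(** Pairing with an arbitrary [w] turns vector identities into scalar ones, within reach of [ring]
    and [field] after expansion by [ipE]. *)
Lemma ip_ext x y : (forall w, ip x w = ip y w) -> x = y.
Proof.
move=> H; apply/eqP; rewrite -subr_eq0 -normr_eq0 -sqrf_eq0 normsqE.
by rewrite ipDl ipNl H subrr.
Qed.

Lemma normsq_extrapolate (c : R) x y w : `|x + c *: (x - y) - w| ^+ 2 =
  (1 + c) * `|x - w| ^+ 2 - c * `|y - w| ^+ 2 + c * (1 + c) * `|x - y| ^+ 2.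
Proof.
by rewrite !normsqE !ipE [ip y x]ipC [ip w x]ipC [ip w y]ipC; ring.
Qed.

(** * Estimates for one relaxed step of a nonexpansive map *)

Context {T : V -> V}.
Hypothesis neT : nonexpansive T.

Lemma krasnoselskii_step (c : R) x f w : T w = w -> 0 <= c <= 1 ->
  let y := x + c *: (T x + f - x) : V in
  `|y - w| ^+ 2 <= `|x - w| ^+ 2 - c * (1 - c) * `|T x - x| ^+ 2
    + 2 * `|y - w| * (c * `|f|).
Proof.
move=> Tw /andP[c0 c1] /=; set y := x + _.
have qE : `|y - w| ^+ 2 = (1 - c) * `|x - w| ^+ 2 + c * `|T x - w| ^+ 2
    - c * (1 - c) * `|T x - x| ^+ 2 + 2 * c * ip (y - w) f - c ^+ 2 * `|f| ^+ 2.
  rewrite !normsqE !ipE ![ip (T x) _]ipC ![ip w _]ipC ![ip f _]ipC; ring.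
have h1 : c * `|T x - w| ^+ 2 <= c * `|x - w| ^+ 2.
  by rewrite ler_wpM2l// lerXn2r ?nnegrE// -{1}Tw neT.
have h2 : 2 * c * ip (y - w) f <= 2 * c * (`|y - w| * `|f|).
  by rewrite ler_wpM2l ?mulr_ge0// cauchy_schwarz.
have h3 : 0 <= c ^+ 2 * `|f| ^+ 2 by rewrite mulr_ge0 ?exprn_ge0.
rewrite {1}qE; lra.
Qed.

(** Nonexpansiveness gives [2 * ip (y - x) d + |d| ^+ 2 <= 0]. Replacing [y - x] by [c *: (T x - x)]
    costs the deviation [h] from the exact step, paired with [d], and [|d| <= 2 * |y - x|]. *)
Lemma residual_decrease (c : R) x y : 0 <= c ->
  let d := (T y - y) - (T x - x) : V in
  (1 - c) * `|d| ^+ 2 + c * (`|T y - y| ^+ 2 - `|T x - x| ^+ 2)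
    <= 4 * `|y - x| * `|y - x - c *: (T x - x)|.
Proof.
move=> c0 /=; set d := T y - y - _; set h := y - x - _.
have Dd : `|(y - x) + d| <= `|y - x|.
  suff -> : (y - x) + d = T y - T x by apply: neT.
  by apply: ip_ext => w; rewrite !ipE; ring.
have d2 : `|d| <= 2 * `|y - x|.
  rewrite (_ : d = ((y - x) + d) - (y - x)); last by rewrite [RHS]addrC addKr.
  by apply: (le_trans (ler_normB _ _)); lra.
have h1 : 2 * ip (y - x) d + `|d| ^+ 2 <= 0.
  have : `|(y - x) + d| ^+ 2 <= `|y - x| ^+ 2 by rewrite lerXn2r ?nnegrE.
  by rewrite normsqD; lra.
have h2 := cauchy_schwarz (- h) d.
have h3 : `|T y - y| ^+ 2 = `|T x - x| ^+ 2 + 2 * ip (T x - x) d + `|d| ^+ 2.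
  by rewrite -normsqD [T x - x + d]addrC subrK.
have h4 : c * ip (T x - x) d = ip (y - x) d + ip (- h) d.
  by rewrite /h !ipE; ring.
have h5 : `|h| * `|d| <= `|h| * (2 * `|y - x|) by rewrite ler_wpM2l.
rewrite normrN in h2; rewrite h3; lra.
Qed.

(** The deviation from the exact step at [x] is [(1 - c) *: (m - x) + c *: (T m - T x) + c *: f].
    The factor 3 is generous. *)
Lemma step_perturbation (c b : R) x y f : 0 <= c <= 1 -> 0 <= b ->
  let m := x + b *: (x - y) : V in
  `|m + c *: (T m + f - m) - x - c *: (T x - x)|
    <= 3 * b * `|x - y| + c * `|f|.
Proof.
move=> /andP[c0 c1] b0 /=; set m := _ + b *: _.
have mx : m - x = b *: (x - y) by rewrite /m addrC addKr.
rewrite (_ : _ - _ = (1 - c) *: (m - x) + c *: (T m - T x) + c *: f); last first.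
  by apply: ip_ext => w; rewrite !ipE; ring.
apply: (le_trans (ler_normD _ _)).
rewrite [`|c *: f|]normrZ (ger0_norm c0) lerD2r.
apply: (le_trans (ler_normD _ _)); rewrite !normrZ (ger0_norm c0) ger0_norm ?subr_ge0//.
have := neT m x; rewrite mx normrZ (ger0_norm b0) => h.
have : c * `|T m - T x| <= c * (b * `|x - y|) by rewrite ler_wpM2l.
have : 0 <= b * `|x - y| by rewrite mulr_ge0.
have : 0 <= c * (b * `|x - y|) by rewrite !mulr_ge0.
lra.
Qed.

(** The step [y - x] is recovered from the next step [g]: each step determines a residual up to its
    error, and the two residuals differ by [d]. In the identity [E] the coefficient of [y - x] is at
    least 1; moving [|T m - T y| <= b * |y - x|] to the left leaves [1 - b]. *)
Lemma step_reconstruction (c0 c1 b : R) x y f : 0 < c0 <= 1 -> 0 < c1 <= 1 ->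
  0 <= b ->
  let m := y + b *: (y - x) : V in
  (1 - b) * `|y - x| <= `|(T y - y) - (T x - x)|
    + `|m + c1 *: (T m + f - m) - y| / c1
    + `|f| + `|y - x - c0 *: (T x - x)| / c0.
Proof.
move=> /andP[c0_gt0 c0_le1] /andP[c1_gt0 c1_le1] b0 /=; set m := _ + b *: _.
set g := m + _ - y; set h := y - x - _; set d := T y - y - _.
have my : m - y = b *: (y - x) by rewrite /m addrC addKr.
have E : (c0^-1 + b / c1 - b) *: (y - x) =
    c1^-1 *: g - f - (T m - T y) - d + c0^-1 *: h.
  apply: ip_ext => w; rewrite /g /h /d /m !ipE.
  by field; rewrite !gt_eqF.
have Tm : `|T m - T y| <= b * `|y - x|.
  by apply: (le_trans (neT _ _)); rewrite my normrZ ger0_norm.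
have c0V : 1 <= c0^-1 by rewrite invr_ge1 ?unitfE ?gt_eqF.
have c1V : 1 <= c1^-1 by rewrite invr_ge1 ?unitfE ?gt_eqF.
have k1 : 1 <= c0^-1 + b / c1 - b.
  have : b * 1 <= b / c1 by rewrite ler_wpM2l.
  lra.
have : 1 * `|y - x| <= `|(c0^-1 + b / c1 - b) *: (y - x)|.
  by rewrite normrZ ler_wpM2r// ger0_norm// (le_trans _ k1).
rewrite E.
have := ler_normD (c1^-1 *: g - f - (T m - T y) - d) (c0^-1 *: h).
have := ler_normB (c1^-1 *: g - f - (T m - T y)) d.
have := ler_normB (c1^-1 *: g - f) (T m - T y).
have := ler_normB (c1^-1 *: g) f.
rewrite !normrZ !gtr0_norm ?invr_gt0// ![_^-1 * _]mulrC; lra.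
Qed.

End Hilbert.

(* [f] is the increment of the residual, [b], [al] two consecutive inertial
   parameters. If [b] is not small compared with [al], then [al * y ^+ 2] is
   dominated by [b * y ^+ 2]; otherwise squaring the second estimate leaves a
   term [al * b ^+ 2 * x ^+ 2] which is a small multiple of [b * x ^+ 2]. *)
Lemma inertia_estimate {R : realFieldType}
  (a th r b al x y w f p q W0 W1 M E : R) :
  let c : R := (1 - th) * (1 - a) ^+ 2 / 2 in
  0 <= a < 1 -> 0 < r -> 0 <= th < 1 -> 0 <= b <= a -> 0 <= al <= a ->
  0 <= x -> 0 <= y <= M -> 0 <= w -> 0 <= f -> 0 <= p <= E -> 0 <= q <= E ->
  (1 - th) * f ^+ 2 <= W0 - W1 + 4 * y * (3 * r * b * x + p) ->
  (1 - a) * y <= f + r * w + q + 3 * r * b * x + p ->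
  c * (al * y ^+ 2) <= W0 - W1 + c / 2 * (b * x ^+ 2)
    + (144 / c + 148) * r ^+ 2 * (b * y ^+ 2 + al * w ^+ 2)
    + 4 * (M + E) * (p + q).
Proof.
move=> c /andP[a0 a1] r0 /andP[th0 th1] /andP[b0 ba] /andP[al0 ala] x0.
move=> /andP[y0 yM] w0 f0 /andP[p0 pE] /andP[q0 qE] H1 H2.
have c0 : 0 < c by rewrite divr_gt0// mulr_gt0// ?exprn_gt0 ?subr_gt0.
have cE : c = (1 - th) * (1 - a) ^+ 2 / 2 by [].
clearbody c.
have M0 : 0 <= M := le_trans y0 yM.
have E0 : 0 <= E := le_trans p0 pE.
have yp : y * p <= M * p by rewrite ler_wpM2r.
have amgm : 12 * r * b * x * y <=
    c / 4 * (b * x ^+ 2) + 144 / c * r ^+ 2 * (b * y ^+ 2).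
  have : 0 <= b * (c / 4) * (x - 24 * r / c * y) ^+ 2.
    by rewrite mulr_ge0 ?sqr_ge0// mulr_ge0// divr_ge0// ltW.
  rewrite (_ : b * (c / 4) * _ = c / 4 * (b * x ^+ 2) - 12 * r * b * x * y +
    144 / c * r ^+ 2 * (b * y ^+ 2)); last by field; rewrite gt_eqF.
  lra.
have k0 : 0 <= 144 / c by rewrite divr_ge0// ltW.
have r2 := sqr_ge0 r.
have by0 := mulr_ge0 b0 (sqr_ge0 y).
have aw0 := mulr_ge0 al0 (sqr_ge0 w).
have bx0 := mulr_ge0 b0 (sqr_ge0 x).
have kaw := mulr_ge0 (mulr_ge0 k0 r2) aw0.
have raw := mulr_ge0 r2 aw0.
have rby := mulr_ge0 r2 by0.
have cbx := mulr_ge0 (ltW c0) bx0.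
have Mq := mulr_ge0 M0 q0.
have Ep := mulr_ge0 E0 p0.
have Eq := mulr_ge0 E0 q0.
(* In the first case [H1] only serves to bound [W1 - W0] from above. In the second the threshold
   gives [36 * r ^+ 2 * al * b ^+ 2 * x ^+ 2 <= c / 4 * (b * x ^+ 2)]; with the [c / 4] from [amgm]
   this makes up the allowed [c / 2]. *)
have [le|lt] := leP (c * al) (144 * r ^+ 2 * b).
  have h1 : c * al * y ^+ 2 <= 144 * r ^+ 2 * b * y ^+ 2.
    by rewrite ler_wpM2r ?sqr_ge0.
  have h2 : 0 <= (1 - th) * f ^+ 2 by rewrite mulr_ge0 ?sqr_ge0 ?subr_ge0 ?ltW.
  lra.
set g := r * w + q + 3 * r * b * x + p.
have g0 : 0 <= g by rewrite /g !addr_ge0// !mulr_ge0// ltW.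
have gE : g = r * w + q + 3 * r * b * x + p by [].
clearbody g.
have h1 : ((1 - a) * y) ^+ 2 <= 2 * f ^+ 2 + 2 * g ^+ 2.
  have : ((1 - a) * y) ^+ 2 <= (f + g) ^+ 2.
    by rewrite lerXn2r ?nnegrE ?addr_ge0 ?mulr_ge0 ?subr_ge0 ?(ltW a1)//; lra.
  by have := sqr_ge0 (f - g); lra.
have h2 : g ^+ 2 <=
    4 * (r ^+ 2 * w ^+ 2 + q ^+ 2 + 9 * r ^+ 2 * b ^+ 2 * x ^+ 2 + p ^+ 2).
  have := sqr_ge0 (r * w - q); have := sqr_ge0 (r * w - 3 * r * b * x).
  have := sqr_ge0 (r * w - p); have := sqr_ge0 (q - 3 * r * b * x).
  have := sqr_ge0 (q - p); have := sqr_ge0 (3 * r * b * x - p).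
  by rewrite gE; lra.
have al1 : al <= 1 by lra.
have sq (t : R) : 0 <= t -> t <= E -> al * t ^+ 2 <= E * t.
  move=> t0 tE; rewrite -[leRHS]mul1r expr2.
  by rewrite ler_pM ?mulr_ge0// ler_wpM2r.
have h3 : 144 * r ^+ 2 * (al * b ^+ 2 * x ^+ 2) <= c * (b * x ^+ 2).
  apply: (@le_trans _ _ (c * al * al * (b * x ^+ 2))).
    have := ler_wpM2r (mulr_ge0 al0 bx0) (ltW lt); lra.
  rewrite ler_wpM2r// -[leRHS]mulr1 -mulrA ler_wpM2l ?(ltW c0)//.
  by rewrite mulr_ile1.
have h4 : al * g ^+ 2 <= 4 * (r ^+ 2 * (al * w ^+ 2) + E * q
    + 9 * r ^+ 2 * (al * b ^+ 2 * x ^+ 2) + E * p).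
  have := ler_wpM2l al0 h2; have := sq _ q0 qE; have := sq _ p0 pE; lra.
have ag : 0 <= al * g ^+ 2 by rewrite mulr_ge0 ?sqr_ge0.
have h5 : (1 - th) * (al * g ^+ 2) <= al * g ^+ 2.
  by rewrite -[leRHS]mul1r ler_wpM2r//; lra.
have h6 : (1 - th) * (al * f ^+ 2) <= (1 - th) * f ^+ 2.
  by rewrite ler_wpM2l ?subr_ge0 ?(ltW th1)// -[leRHS]mul1r ler_wpM2r ?sqr_ge0.
have h7 : c * (al * y ^+ 2) <= (1 - th) * (al * f ^+ 2) + (1 - th) * (al * g ^+ 2).
  have ath : 0 <= (1 - th) / 2 * al by rewrite !mulr_ge0// ?subr_ge0 ?invr_ge0 ltW.
  have := ler_wpM2l ath h1; rewrite cE; lra.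
lra.
Qed.

(* Young's inequality is used with weight [b + delta * c], as in the analysis
   of Bot, Csetnek and Hendrich; [G] is the resulting bound for the coefficient
   of [`|z - y| ^+ 2], and [hc] the upper bound on the relaxation parameter. *)
Lemma inertial_descent {R : realType} {V : normedModType R} {ip : V -> V -> R}
  (ipH : inner_product_norm ip) {T : V -> V} (neT : nonexpansive T)
  (a b c sigma delta : R) (z y f w : V) :
  T w = w -> 0 <= b <= a -> a < 1 -> 0 < c <= 1 -> 0 < delta ->
  let G := a * (1 + a) + a * delta in
  c * (delta * (1 + G + sigma)) <= delta - a * (G + sigma) -> 0 <= sigma ->
  let m := z + b *: (z - y) : V in
  let z' := m + c *: (T m + f - m) : V in
  `|z' - w| ^+ 2 - `|z - w| ^+ 2 - b * (`|z - w| ^+ 2 - `|y - w| ^+ 2)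
    <= G * `|z - y| ^+ 2 - (G + sigma) * `|z' - z| ^+ 2
     + 2 * (`|z' - w| + `|z' - z| + `|z - y|) * `|f|.
Proof.
move=> Tw /andP[b0 ba] a1 /andP[c0 c1] d0 G hc s0 /=.
have GE : G = a * (1 + a) + a * delta by [].
clearbody G.
have a0 : 0 <= a := le_trans b0 ba.
have G0 : 0 <= G by rewrite GE; apply: addr_ge0; apply: mulr_ge0 => //; lra.
have := krasnoselskii_step ipH neT c (z + b *: (z - y)) f w Tw.
rewrite (ltW c0) c1 => /(_ isT) /=.
rewrite (normsq_extrapolate ipH).
set m := z + b *: (z - y); set z' := m + _.
set D1 := z' - z; set D0 := z - y; set F := T m - m => H.
(* The update is solved for the residual, so the residual term of the Fejer inequality becomes a
   bound in terms of the two steps. *)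
have FE : c *: F = (D1 - b *: D0) - c *: f.
  by apply: (ip_ext ipH) => u; rewrite /F /D1 /z' /D0 /m !(ipE ipH); ring.
have F2 : c ^+ 2 * `|F| ^+ 2 >=
    `|D1 - b *: D0| ^+ 2 - 2 * c * `|D1 - b *: D0| * `|f|.
  have -> : c ^+ 2 * `|F| ^+ 2 = `|(D1 - b *: D0) - c *: f| ^+ 2.
    by rewrite -FE normrZ exprMn real_normK// num_real.
  rewrite (normsq_subZ ipH _ (D1 - b *: D0)).
  have := ler_wpM2l (ltW c0) (cauchy_schwarz ipH (D1 - b *: D0) f).
  by have := mulr_ge0 (sqr_ge0 c) (sqr_ge0 `|f|); lra.
have nDD : `|D1 - b *: D0| <= `|D1| + `|D0|.
  apply: (le_trans (ler_normB _ _)); rewrite lerD2l normrZ ger0_norm//.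
  by rewrite -[leRHS]mul1r ler_wpM2r//; lra.
have h0 : 0 < b + delta * c by rewrite ltr_wpDl// mulr_gt0.
set h := b + delta * c in h0.
have young : `|D1 - b *: D0| ^+ 2 >=
    delta * c * (`|D1| ^+ 2 / h) - b * delta * c * `|D0| ^+ 2.
  have := sqr_ge0 `|D1 - h *: D0|.
  rewrite !(normsq_subZ ipH) => sq.
  have := mulr_ge0 (divr_ge0 b0 (ltW h0)) sq.
  rewrite (_ : b / h * _ = b * (`|D1| ^+ 2 / h) - 2 * b * ip D1 D0
    + b * h * `|D0| ^+ 2); last by field; rewrite gt_eqF.
  have d1E : `|D1| ^+ 2 = (b + delta * c) * (`|D1| ^+ 2 / h).
    by rewrite -/h; field; rewrite gt_eqF.
  move: (`|D1| ^+ 2 / h) d1E => Y ->.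
  by rewrite {1}/h; lra.
have kc : 0 <= (1 - c) / c by rewrite divr_ge0 ?subr_ge0// ltW.
have F3 : c * (1 - c) * `|F| ^+ 2 >=
    (1 - c) * delta * (`|D1| ^+ 2 / h) - (1 - c) * b * delta * `|D0| ^+ 2
    - 2 * (1 - c) * `|D1 - b *: D0| * `|f|.
  have := ler_wpM2l kc (le_trans (lerD young (lexx (- (2 * c * `|D1 - b *: D0| * `|f|)))) F2).
  rewrite (_ : (1 - c) / c * (c ^+ 2 * _) = c * (1 - c) * `|F| ^+ 2); last first.
    by field; rewrite gt_eqF.
  apply: le_trans; rewrite le_eqVlt; apply/orP; left; apply/eqP.
  by field; rewrite !gt_eqF.
(* The hypothesis [hc] rearranges to [(G + sigma) * (a + delta * c) <= (1 - c) * delta], and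
   [h <= a + delta * c]. *)
have gap : (G + sigma) * `|D1| ^+ 2 <= (1 - c) * delta * (`|D1| ^+ 2 / h).
  have X0 : 0 <= `|D1| ^+ 2 / h by rewrite divr_ge0 ?sqr_ge0// ltW.
  have -> : (G + sigma) * `|D1| ^+ 2 = ((G + sigma) * h) * (`|D1| ^+ 2 / h).
    by field; rewrite gt_eqF.
  apply: ler_wpM2r => //; rewrite /h.
  have : (G + sigma) * b <= (G + sigma) * a by rewrite ler_wpM2l// addr_ge0.
  by lra.
have coef : (b * (1 + b) + (1 - c) * b * delta) * `|D0| ^+ 2 <= G * `|D0| ^+ 2.
  apply: ler_wpM2r; rewrite ?sqr_ge0// GE.
  have : b * (1 + b) <= a * (1 + a) by rewrite ler_pM//; lra.
  have : (1 - c) * (b * delta) <= b * delta.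
    by rewrite -[leRHS]mul1r ler_wpM2r ?mulr_ge0 ?(ltW d0)//; lra.
  have : b * delta <= a * delta by rewrite ler_wpM2r// ltW.
  by lra.
have err1 : `|z' - w| * (c * `|f|) <= `|z' - w| * `|f|.
  by rewrite ler_wpM2l// -[leRHS]mul1r ler_wpM2r.
have err2 : (1 - c) * (`|D1 - b *: D0| * `|f|) <= (`|D1| + `|D0|) * `|f|.
  rewrite -[leRHS]mul1r ler_pM ?mulr_ge0 ?subr_ge0//; first by lra.
  by rewrite ler_wpM2r.
lra.
Qed.

(** * Summability of the inertial terms along the iteration *)

Section Iteration.
Context {R : realType} {V : normedModType R} {ip : V -> V -> R}.
Hypothesis ipH : inner_product_norm ip.
Context {T : V -> V}.
Hypothesis neT : nonexpansive T.
Context {z : nat -> V} {zm1 : V} {e : nat -> V} {alpha lam : nat -> R}.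
Hypothesis zS : forall k, z k.+1 = mu_seq z zm1 alpha k
  + lam k *: (T (mu_seq z zm1 alpha k) + e k - mu_seq z zm1 alpha k).
Context {a l th : R}.
Hypothesis a01 : 0 <= a < 1.
Hypothesis alphaP : forall k, 0 <= alpha k <= a.
Hypothesis l0 : 0 < l.
Hypothesis th1 : th < 1.
Hypothesis lamP : forall k, l <= lam k <= th.
Hypothesis z_bounded : exists M : R, forall k, `|z k| <= M.
Hypothesis e_summable : bounded_sums (fun k => `|e k|).

Local Notation step k := (`|z k - zprev z zm1 k|).

Let lam01 k : 0 < lam k <= 1.
Proof.
have /andP[ll lt] := lamP k.
by rewrite (lt_le_trans l0 ll) (le_trans lt (ltW th1)).
Qed.

Lemma dist_bounded w : exists2 M : R, 0 <= M & forall k, `|z k - w| <= M.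
Proof.
have [M HM] := z_bounded; exists (M + `|w|).
  by rewrite addr_ge0// (le_trans (normr_ge0 (z 0)) (HM 0)).
by move=> k; rewrite (le_trans (ler_normB _ _))// lerD2r.
Qed.

Lemma step_bounded : exists2 M : R, 0 <= M & forall k, step k <= M.
Proof.
have [M M0 HM] := dist_bounded 0; exists (2 * M + `|zm1|).
  by rewrite addr_ge0// mulr_ge0.
have HM' k : `|z k| <= M by have := HM k; rewrite subr0.
case=> [|k]; rewrite (le_trans (ler_normB _ _))//=.
  by rewrite lerD2r; have := HM' 0; lra.
by have := HM' k; have := HM' k.+1; have := normr_ge0 zm1; lra.
Qed.

Lemma inertia_summable_of_shift :
  bounded_sums (fun k => alpha k * `|z k.+1 - z k| ^+ 2) ->
  bounded_sums (fun k => alpha k * step k ^+ 2).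
Proof.
move=> HY.
have [a0 a1] := andP a01.
have [M M0 HM] := step_bounded.
have [E HE] := bounded_sums_term _ (fun k => normr_ge0 (e k)) e_summable.
have th0 : 0 <= th.
  have /andP[ll lt] := lamP 0.
  exact: le_trans (ltW l0) (le_trans ll lt).
pose W k := `|T (z k) - z k| ^+ 2.
set c : R := (1 - th) * (1 - a) ^+ 2 / 2.
have c0 : 0 < c by rewrite divr_gt0// mulr_gt0// ?exprn_gt0 ?subr_gt0.
pose C1 : R := (144 / c + 148) * l^-1 ^+ 2.
pose Y k := alpha k * `|z k.+1 - z k| ^+ 2.
have alpha0 k : 0 <= alpha k by have /andP[] := alphaP k.
have Y0 k : 0 <= Y k by rewrite mulr_ge0 ?sqr_ge0.
have E0 : 0 <= E := le_trans (normr_ge0 (e 0)) (HE 0).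
have C10 : 0 <= C1.
  by rewrite mulr_ge0 ?sqr_ge0// addr_ge0// divr_ge0// ltW.
(* The recursion comes from [inertia_estimate] with [r = l^-1], at the consecutive steps ending at
   [z k], [z k.+1] and [z k.+2]. The terms [Y k] and [Y k.+1] are summable by assumption. *)
apply: (@bounded_sums_rec _ _ W (fun k => C1 * (Y k + Y k.+1) +
  4 * (M + E) * (`|e k| + `|e k.+1|)) (c / 2) c 0).
- by lra.
- by lra.
- by move=> k; rewrite mulr_ge0 ?sqr_ge0.
- by move=> k; rewrite sqr_ge0.
- apply: bounded_sumsD; apply: bounded_sumsZ => //.
  + by apply: bounded_sumsD => //; exact: (bounded_sumsS _ Y0).
  + by rewrite mulr_ge0// addr_ge0.
  + by apply: bounded_sumsD => //; exact: (bounded_sumsS _ (fun k => normr_ge0 (e k))).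
move=> k; rewrite addrA.
pose f := `|(T (z k.+1) - z k.+1) - (T (z k) - z k)|.
have [lk0 lk1] := andP (lam01 k).
have [lk2 lk3] := andP (lamP k).
have lV : (lam k)^-1 <= l^-1 by rewrite lef_pV2.
pose h := `|z k.+1 - z k - lam k *: (T (z k) - z k)|.
have hP : h / lam k <= 3 * l^-1 * alpha k * step k + `|e k|.
  have := step_perturbation ipH neT (lam k) (alpha k) (z k) (zprev z zm1 k) (e k).
  rewrite (ltW lk0) lk1 => /(_ isT (alpha0 k)) /=.
  rewrite -/(mu_seq z zm1 alpha k) -zS -/h => hle.
  rewrite ler_pdivrMr// (le_trans hle)// [leRHS]mulrDl [`|e k| * _]mulrC lerD2r.
  have : 1 <= l^-1 * lam k by rewrite mulrC ler_pdivlMr ?mul1r.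
  have : 0 <= 3 * alpha k * step k by rewrite !mulr_ge0.
  move=> + /ler_wpM2l H => /H; lra.
apply: (@inertia_estimate _ a th l^-1 _ _ _ _ _ f _ _ _ _ M E) => //.
- by rewrite invr_gt0.
- by rewrite th0.
- by rewrite normr_ge0 (HM k.+1).
- exact: normr_ge0.
- by rewrite normr_ge0 HE.
- by rewrite normr_ge0 HE.
- have := residual_decrease ipH neT (lam k) (z k) (z k.+1) (ltW lk0).
  rewrite /= -/f -/h -/(W k) -/(W k.+1) => H.
  have {}H : (1 - lam k) / lam k * f ^+ 2 + (W k.+1 - W k)
      <= 4 * `|z k.+1 - z k| * (h / lam k).
    move: H; rewrite -(ler_pM2l (x := (lam k)^-1)) ?invr_gt0//.
    rewrite (_ : _ * (_ + _) = (1 - lam k) / lam k * f ^+ 2 + (W k.+1 - W k)).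
      by rewrite [_^-1 * _]mulrC mulrA.
    by field; rewrite gt_eqF.
  have : (1 - th) * f ^+ 2 <= (1 - lam k) / lam k * f ^+ 2.
    rewrite ler_wpM2r ?sqr_ge0// ler_pdivlMr//.
    have : (1 - th) * lam k <= (1 - th) * 1.
      by rewrite ler_wpM2l// subr_ge0 ltW.
    by lra.
  have : 4 * `|z k.+1 - z k| * (h / lam k) <=
    4 * `|z k.+1 - z k| * (3 * l^-1 * alpha k * step k + `|e k|).
    by rewrite ler_wpM2l// mulr_ge0.
  by lra.
- have := step_reconstruction ipH neT (lam k) (lam k.+1) (alpha k.+1) (z k) (z k.+1)
    (e k.+1) (lam01 k) (lam01 k.+1) (alpha0 k.+1).
  rewrite /= -/(mu_seq z zm1 alpha k.+1) -zS -/f -/h => H.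
  have : `|z k.+2 - z k.+1| / lam k.+1 <= l^-1 * `|z k.+2 - z k.+1|.
    have [p0 _] := andP (lam01 k.+1); have [p1 _] := andP (lamP k.+1).
    by rewrite mulrC ler_wpM2r// lef_pV2.
  have : (1 - a) * `|z k.+1 - z k| <= (1 - alpha k.+1) * `|z k.+1 - z k|.
    by rewrite ler_wpM2r// lerD2l lerN2; have /andP[] := alphaP k.+1.
  by lra.
Qed.

Lemma step_summable (sigma delta : R) w : T w = w ->
  (forall k, alpha k <= alpha k.+1) -> 0 < sigma -> 0 < delta ->
  (forall k, lam k <= (delta - a * (a * (1 + a) + a * delta + sigma))
                / (delta * (1 + a * (1 + a) + a * delta + sigma))) ->
  bounded_sums (fun k => step k ^+ 2).
Proof.
move=> Tw mono s0 d0 lamle.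
have [a0 a1] := andP a01.
pose G := a * (1 + a) + a * delta.
have G0 : 0 <= G by rewrite addr_ge0// mulr_ge0//; lra.
have alpha0 k : 0 <= alpha k by have /andP[] := alphaP k.
have [M M0 HM] := dist_bounded w.
have [N N0 HN] := step_bounded.
(* The maximum is needed at [k = 0], where [zprev] is [zm1]. *)
pose B := Num.max M `|zm1 - w|.
have HB k : `|zprev z zm1 k - w| <= B.
  by case: k => [|k] /=; rewrite le_max ?lexx ?orbT// HM.
pose W k := `|z k - w| ^+ 2 - alpha k * `|zprev z zm1 k - w| ^+ 2 + G * step k ^+ 2.
apply: (@bounded_sums_rec _ _ W (fun k => 2 * (M + N + N) * `|e k|) 0 sigma (- B ^+ 2)).
- by [].
- by [].
- by move=> k; rewrite sqr_ge0.
- move=> k; rewrite /W.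
  have : alpha k * `|zprev z zm1 k - w| ^+ 2 <= 1 * B ^+ 2.
    rewrite ler_pM ?sqr_ge0//; first by have /andP[_] := alphaP k; lra.
    by rewrite lerXn2r ?nnegrE// (le_trans _ (HB k)).
  have := sqr_ge0 `|z k - w|; have := mulr_ge0 G0 (sqr_ge0 (step k)); lra.
- by apply: bounded_sumsZ; rewrite // !mulr_ge0// !addr_ge0.
move=> k; rewrite mul0r addr0.
have := inertial_descent ipH neT a (alpha k) (lam k) sigma delta (z k)
  (zprev z zm1 k) (e k) w Tw (alphaP k) a1 (lam01 k) d0.
rewrite /= -/(mu_seq z zm1 alpha k) -zS -/G => /(_ _ (ltW s0)).
have -> : lam k * (delta * (1 + G + sigma)) <= delta - a * (G + sigma).
  have := lamle k; rewrite ler_pdivlMr /G ?addrA//.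
  by rewrite mulr_gt0//; move: G0; rewrite /G; lra.
move=> /(_ isT) H.
(* Monotonicity of [alpha] lets [alpha k] become [alpha k.+1], so that the left side turns into
   [W k.+1 - W k]. *)
have m : alpha k * `|z k - w| ^+ 2 <= alpha k.+1 * `|z k - w| ^+ 2.
  by rewrite ler_wpM2r ?sqr_ge0.
have : (`|z k.+1 - w| + `|z k.+1 - z k| + step k) * `|e k| <= (M + N + N) * `|e k|.
  by rewrite ler_wpM2r// !lerD// (HN k.+1).
by rewrite /W /=; lra.
Qed.

(** * Finiteness of Delta and the residual bound *)

Section Rate.
Context {w : V}.
Hypothesis Tw : T w = w.

Local Notation incr k := (Num.max (`|z k - w| ^+ 2 - `|z k.-1 - w| ^+ 2) 0).
Local Notation err k := (2 * `|z k.+1 - w| * (lam k * `|e k|)).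
Local Notation inertia k := (alpha k * (1 + alpha k) * `|z k - z k.-1| ^+ 2).
Local Notation m k := (mu_seq z zm1 alpha k).
Local Notation res k := (`|T (m k) - m k| ^+ 2).

(** Starting at index 1 keeps [zm1] out of the inequality. The signed increment, weighted by
    [alpha], is enlarged to [a] times its positive part. *)
Lemma fejer_step k : l * (1 - th) * res k.+1 + `|z k.+2 - w| ^+ 2
  <= `|z k.+1 - w| ^+ 2 + a * incr k.+1 + err k.+1 + inertia k.+1.
Proof.
have [lk0 lk1] := andP (lam01 k.+1).
have := krasnoselskii_step ipH neT (lam k.+1) (m k.+1) (e k.+1) w Tw.
rewrite (ltW lk0) lk1 => /(_ isT) /=; rewrite -zS.
rewrite {2}/mu_seq (normsq_extrapolate ipH) /= => H.
have : alpha k.+1 * (`|z k.+1 - w| ^+ 2 - `|z k - w| ^+ 2) <= a * incr k.+1.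
  have [b0 ba] := andP (alphaP k.+1).
  apply: (@le_trans _ _ (alpha k.+1 * incr k.+1)).
    by rewrite ler_wpM2l// le_max lexx.
  by rewrite ler_wpM2r// le_max lexx orbT.
have : l * (1 - th) * res k.+1 <= lam k.+1 * (1 - lam k.+1) * res k.+1.
  have [ll lt] := andP (lamP k.+1).
  rewrite ler_wpM2r ?sqr_ge0// ler_pM ?(ltW l0) ?subr_ge0 ?(ltW th1)//.
  by rewrite lerD2l lerN2.
move: H; rewrite /=; lra.
Qed.

Let incr_ge0 k : 0 <= incr k.
Proof. by rewrite le_max lexx orbT. Qed.

Let err_ge0 k : 0 <= err k.
Proof.
by rewrite mulr_ge0 ?mulr_ge0//; have /andP[/ltW] := lam01 k.
Qed.

Let inertia_ge0 k : 0 <= inertia k.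
Proof.
have /andP[b0 _] := alphaP k.
by rewrite mulr_ge0 ?sqr_ge0// mulr_ge0// addr_ge0.
Qed.

Lemma err_summable : bounded_sums (fun k => err k.+1).
Proof.
have [M M0 HM] := dist_bounded w.
apply: (@le_bounded_sums _ _ (fun k => 2 * M * `|e k.+1|)) => [k|].
  rewrite ler_pM ?mulr_ge0//; first by have /andP[/ltW] := lam01 k.+1.
    by rewrite ler_wpM2l.
  by rewrite -[leRHS]mul1r ler_wpM2r//; have /andP[] := lam01 k.+1.
apply: bounded_sumsZ; first by rewrite mulr_ge0.
exact: (bounded_sumsS _ (fun k => normr_ge0 (e k))).
Qed.

Hypothesis inertia_summable : bounded_sums (fun k => alpha k * step k ^+ 2).

Lemma extrapolation_summable : bounded_sums (fun k => inertia k.+1).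
Proof.
have a1 : a <= 1 by have /andP[_ /ltW] := a01.
have alpha0 k : 0 <= alpha k by have /andP[] := alphaP k.
apply: (@le_bounded_sums _ _ (fun k => 2 * (alpha k.+1 * step k.+1 ^+ 2))) => [k|].
  rewrite mulrAC mulrC ler_wpM2r ?mulr_ge0 ?sqr_ge0//.
  by rewrite lerD2l (le_trans _ a1)//; have /andP[] := alphaP k.+1.
apply: bounded_sumsZ => //.
apply: (bounded_sumsS (fun k => alpha k * step k ^+ 2)) => // k.
by rewrite mulr_ge0 ?sqr_ge0.
Qed.

(** Without its residual term, [fejer_step] bounds the next increment by a nonnegative quantity,
    hence also its positive part. *)
Lemma incr_summable : bounded_sums (fun k => incr k.+1).
Proof.
have [a0 a1] := andP a01.
apply: (@bounded_sums_rec _ _ (fun=> 0) (fun k => err k.+1 + inertia k.+1) a 1 0) => //.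
  by apply: bounded_sumsD; [exact: err_summable | exact: extrapolation_summable].
move=> k; rewrite mul1r subrr add0r ge_max.
have := fejer_step k; have := err_ge0 k.+1; have := inertia_ge0 k.+1.
have := mulr_ge0 a0 (incr_ge0 k.+1).
have : 0 <= l * (1 - th) * res k.+1.
  by rewrite mulr_ge0 ?sqr_ge0// mulr_ge0 ?subr_ge0 ?ltW.
move=> /= *; apply/andP; split; lra.
Qed.

Lemma sum_residual n : l * (1 - th) * \sum_(k < n) res k.+1 <=
  `|z 1 - w| ^+ 2 + (a * \sum_(k < n) incr k.+1 + \sum_(k < n) err k.+1
    + \sum_(k < n) inertia k.+1).
Proof.
suff H : l * (1 - th) * \sum_(k < n) res k.+1 + `|z n.+1 - w| ^+ 2 <=
  `|z 1 - w| ^+ 2 + (a * \sum_(k < n) incr k.+1 + \sum_(k < n) err k.+1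
    + \sum_(k < n) inertia k.+1).
  by apply: le_trans H; rewrite lerDl sqr_ge0.
elim: n => [|n IHn]; first by rewrite !big_ord0 !mulr0 !addr0 add0r.
rewrite !big_ord_recr/= !mulrDr; have := fejer_step n; rewrite /=; lra.
Qed.

Lemma residual_rate :
  let Delta : \bar R :=
    (a%:E * (\sum_(1 <= k <oo) (incr k)%:E) + \sum_(1 <= k <oo) (err k)%:E
     + \sum_(1 <= k <oo) (inertia k)%:E)%E in
  (Delta < +oo)%E /\
  forall k : nat, (1 <= k)%N ->
    (\big[Order.min/+oo%E]_(1 <= i < k.+1) (res i)%:E
     <= ((`|z 1 - w| ^+ 2)%:E + Delta) * ((k%:R * l * (1 - th))^-1)%:E)%E.
Proof.
have [a0 a1] := andP a01.
move=> Delta; split.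
  rewrite /Delta; apply: lte_add_pinfty; first apply: lte_add_pinfty.
  - apply: lte_mul_pinfty; rewrite ?lee_fin//.
    by apply: (nneseries1_lt_pinfty (fun k => incr k)) => //; exact: incr_summable.
  - by apply: (nneseries1_lt_pinfty (fun k => err k)) => //; exact: err_summable.
  - apply: (nneseries1_lt_pinfty (fun k => inertia k)) => //.
    exact: extrapolation_summable.
move=> n n1.
(* The estimate is made with the real partial sum [D], which lies below the extended-real
   [Delta]. *)
set D := a * \sum_(k < n) incr k.+1 + \sum_(k < n) err k.+1
    + \sum_(k < n) inertia k.+1.
have DDelta : (D%:E <= Delta)%E.
  rewrite /D /Delta !EFinD EFinM; apply: leeD; first apply: leeD.
  - rewrite lee_wpmul2l ?lee_fin//.
    exact: (sum_le_nneseries1 (fun k => incr k)).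
  - exact: (sum_le_nneseries1 (fun k => err k)).
  - exact: (sum_le_nneseries1 (fun k => inertia k)).
have den : 0 < n%:R * l * (1 - th) by rewrite !mulr_gt0 ?subr_gt0 ?ltr0n.
set r := (`|z 1 - w| ^+ 2 + D) / (n%:R * l * (1 - th)).
apply: (@le_trans _ _ r%:E); last first.
  rewrite /r EFinM EFinD lee_wpmul2r ?lee_fin ?invr_ge0 ?(ltW den)//.
  by rewrite leeD2l.
rewrite big_add1/= big_mkord.
(* A minimum is at most the average: if all [n] residuals exceeded [r], their sum would contradict
   [sum_residual]. *)
have [i ri] : exists i : 'I_n, res i.+1 <= r.
  apply/not_existsP => H.
  have lt_res (k : 'I_n) : r < res k.+1 by rewrite ltNge; apply/negP/H.
  have : \sum_(k < n) r < \sum_(k < n) res k.+1.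
    by apply: ltr_sum => [|k _]; [apply/hasP; exists (Ordinal n1); rewrite ?mem_index_enum | exact: lt_res].
  rewrite ltNge => /negP; apply.
  rewrite sumr_const card_ord -[_ *+ n]mulr_natl /r.
  rewrite mulrA ler_pdivlMr//.
  have := ler_wpM2l (ler0n R n) (sum_residual n); rewrite -/D; lra.
apply: (@le_trans _ _ (res i.+1)%:E); last by rewrite lee_fin.
exact: bigmin_le.
Qed.

End Rate.

End Iteration.

Theorem theorem3 (R : realType) (V : completeNormedModType R)
  (ip : V -> V -> R) (T : V -> V)
  (z : nat -> V) (zm1 : V) (e : nat -> V) (alpha lam : nat -> R)
  (a l l' sigma delta theta : R) :
  inner_product_norm ip ->
  nonexpansive T ->
  (exists x : V, T x = x) ->
  (forall k, z k.+1 = mu_seq z zm1 alpha k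
      + lam k *: (T (mu_seq z zm1 alpha k) + e k - mu_seq z zm1 alpha k)) ->
  ( (* Case 1 *)
    (0 <= a < 1) /\ 0 < l /\ l <= l' /\ l' < 1 /\
    (forall k, 0 <= alpha k <= a) /\
    (forall k, l <= lam k <= l') /\
    (\sum_(0 <= k <oo) ((alpha k * `|z k.+1 - z k| ^+ 2)%:E) < +oo)%E /\
    (\sum_(0 <= k <oo) ((lam k * `|e k|)%:E) < +oo)%E /\
    (exists M : R, forall k, `|z k| <= M) /\
    theta = l'
  \/
    (* Case 2 *)
    (forall k, alpha k <= alpha k.+1) /\ (forall k, lam k <= lam k.+1) /\
    (0 <= a < 1) /\ (forall k, 0 <= alpha k <= a) /\ alpha 0 = 0 /\
    0 < l /\ 0 < sigma /\ 0 < delta /\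
    a * (a * (1 + a) + sigma) / (1 - a ^+ 2) < delta /\
    (forall k, l <= lam k /\
       lam k <= (delta - a * (a * (1 + a) + a * delta + sigma))
                / (delta * (1 + a * (1 + a) + a * delta + sigma))) /\
    (exists M : R, forall k, `|z k| <= M) /\
    (\sum_(0 <= k <oo) (`|e k|%:E) < +oo)%E /\
    theta = (delta - a * (a * (1 + a) + a * delta + sigma))
            / (delta * (1 + a * (1 + a) + a * delta + sigma))) ->
  forall zs : V, T zs = zs ->
  let Delta : \bar R :=
    ((a%:E * \sum_(1 <= k <oo)
          ((Num.max (`|z k - zs| ^+ 2 - `|z k.-1 - zs| ^+ 2) 0)%:E))
     + \sum_(1 <= k <oo) ((2 * `|z k.+1 - zs| * (lam k * `|e k|))%:E)
     + \sum_(1 <= k <oo)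
          ((alpha k * (1 + alpha k) * `|z k - z k.-1| ^+ 2)%:E))%E in
  (Delta < +oo)%E /\
  forall k : nat, (1 <= k)%N ->
    (\big[Order.min/+oo%E]_(1 <= i < k.+1)
        ((`|T (mu_seq z zm1 alpha i) - mu_seq z zm1 alpha i| ^+ 2)%:E)
     <= ((`|z 1 - zs| ^+ 2)%:E + Delta)
        * ((k%:R * l * (1 - theta))^-1)%:E)%E.
Proof.
move=> ipH neT _ zS H zs Tzs.
case: H => [[a01 [l0 [ll' [l'1 [alphaP [lamP [Y [se [zb ->]]]]]]]]]|].
  have lam0 k : 0 <= lam k by have /andP[/(le_trans (ltW l0))] := lamP k.
  have alpha0 k : 0 <= alpha k by have /andP[] := alphaP k.
  (* The weights [lam k] are at least [l], so they can be removed at the cost of [l^-1]. *)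
  have es : bounded_sums (fun k => `|e k|).
    apply: (@le_bounded_sums _ _ (fun k => l^-1 * (lam k * `|e k|))) => [k|].
      rewrite mulrA -[leLHS]mul1r ler_wpM2r// mulrC ler_pdivlMr// mul1r.
      by have /andP[] := lamP k.
    apply: bounded_sumsZ; first by rewrite invr_ge0 ltW.
    by apply: bounded_sums_lt_pinfty => // k; rewrite mulr_ge0.
  apply: (residual_rate ipH neT zS a01 alphaP l0 l'1 lamP zb es Tzs).
  apply: (inertia_summable_of_shift ipH neT zS a01 alphaP l0 l'1 lamP zb es).
  by apply: bounded_sums_lt_pinfty => // k; rewrite mulr_ge0 ?sqr_ge0.
move=> [mono [_ [a01 [alphaP [_ [l0 [s0 [d0 [_ [lamP' [zb [se ->]]]]]]]]]]]].
set th := (X in 1 - X).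
have [a0 a1] := andP a01.
have lamP k : l <= lam k <= th by apply/andP; have [] := lamP' k.
(* The numerator is at most [delta], while the denominator exceeds [delta] by at least
   [delta * sigma > 0]. *)
have th1 : th < 1.
  have p1 : 0 <= a * (1 + a) by rewrite mulr_ge0 ?addr_ge0.
  have p2 : 0 <= a * delta by rewrite mulr_ge0 ?(ltW d0).
  have p3 : 0 <= a * (a * (1 + a) + a * delta + sigma).
    by rewrite mulr_ge0// !addr_ge0 ?(ltW s0).
  have p4 : 0 <= delta * (a * (1 + a) + a * delta).
    by rewrite mulr_ge0 ?addr_ge0 ?(ltW d0).
  have p5 : 0 < delta * sigma by rewrite mulr_gt0.
  by rewrite ltr_pdivrMr ?mul1r ?mulr_gt0//; lra.
have es : bounded_sums (fun k => `|e k|) by exact: bounded_sums_lt_pinfty.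
apply: (residual_rate ipH neT zS a01 alphaP l0 th1 lamP zb es Tzs).
apply: (@le_bounded_sums _ _ (fun k => `|z k - zprev z zm1 k| ^+ 2)) => [k|].
  rewrite -[leRHS]mul1r ler_wpM2r ?sqr_ge0//.
  by have /andP[_ /le_trans] := alphaP k; apply; exact: ltW.
apply: (step_summable ipH neT zS a01 alphaP l0 th1 lamP zb es _ _ _ Tzs mono s0 d0).
by move=> k; have [] := lamP' k.
Qed.
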